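(* For any finite two-player normal-form game $G$ (and simulation cost $c>0$), there exists a finite subgame $G'_{\text{m-sim}}$ of the mixed-strategy simulation game $G_{\text{m-sim}}=G^c_{\text{m-sim}}$ such that: (i) $\mathrm{NE}(G'_{\text{m-sim}})\subseteq \mathrm{NE}(G_{\text{m-sim}})$; (ii) for every $\mu\in\mathrm{NE}(G_{\text{m-sim}})$ there exists $\mu'\in\mathrm{NE}(G'_{\text{m-sim}})$ with $u(\mu')=u(\mu)$.
   Context: A two-player normal-form game (NFG) $G=(S_1,S_2,u)$ has nonempty pure strategy sets (finite unless stated otherwise) and $u=(u_1,u_2):S_1\times S_2\to\mathbb R^2$. $\Sigma_i=\Delta(S_i)$, $u$ is extended by expectation, $\mathrm{NE}(G)$ is the set of Nash equilibria. A subgame of $G$ is a game $(S_1',S_2',u)$ with $S_i'\subseteq S_i$ and utilities restricted from $G$. For $\sigma_2\in\Sigma_2$, $\mathrm{br}(\sigma_2)\subseteq S_1$ is the set of pure best responses of player 1 and $\text{f-br}(\sigma_2)=\arg\max_{t_1\in \mathrm{br}(\sigma_2)}u_2(t_1,\sigma_2)$. For a simulation cost $c>0$, the mixed-strategy simulation game $G^c_{\text{m-sim}}$ is the (infinite) NFG in which player 1's pure strategies are $S_1\cup\{\text{m-sim}\}$, player 2's pure strategies are $\Sigma_2$ (all mixed strategies of player 2 in $G$), $u(s_1,\sigma_2)$ is as in $G$ for $s_1\in S_1$, and $$u_1(\text{m-sim},\sigma_2)=u_1(\mathrm{br}(\sigma_2),\sigma_2)-c,\qquad u_2(\text{m-sim},\sigma_2)=u_2(\text{f-br}(\sigma_2),\sigma_2).$$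 Mixed strategies of player 2 in $G^c_{\text{m-sim}}$ are (Borel) probability distributions over $\Sigma_2$; Nash equilibria are defined as usual. Mixed strategies of a subgame are regarded as mixed strategies of $G^c_{\text{m-sim}}$ supported on the smaller strategy sets. *)

(* Defs.v *)
From HB Require Import structures.
From mathcomp Require Import all_boot all_order all_algebra.
From mathcomp Require Import all_classical all_reals all_analysis.

Set Implicit Arguments.
Unset Strict Implicit.
Unset Printing Implicit Defensive.

Import Order.TTheory GRing.Theory Num.Theory numFieldNormedType.Exports.

Local Open Scope classical_set_scope.
Local Open Scope ring_scope.

(* Delta(T) as a subset of R^T with its product topology; the associated type
   carries the subset topology. *)
Definition simplex (R : realType) (T : finType) : set {ptws T -> R} :=
  [set p | (forall t, 0 <= p t) /\ \sum_t p t = 1].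
Arguments simplex : clear implicits.

Definition vertex (R : realType) (T : finType) (t : T) : {ptws T -> R} :=
  fun t' => (t' == t)%:R.
Arguments vertex R {T} t.

Lemma vertex_simplex (R : realType) (T : finType) (t : T) :
  vertex R t \in simplex R T.
Proof.
rewrite inE; split => [t'|]; first exact: ler0n.
rewrite (bigD1 t) //= /vertex eqxx big1 ?addr0 // => t' /negPf -> //.
Qed.

Record game (R : realType) := Game {
  pure1 : finType;
  pure2 : finType;
  u1 : pure1 -> pure2 -> R;
  u2 : pure1 -> pure2 -> R;
  pure1_gt0 : (0 < #|pure1|)%N;
  pure2_gt0 : (0 < #|pure2|)%N
}.

Definition mixed2 (R : realType) (G : game R) : Type := simplex R (pure2 G).

HB.instance Definition _ (R : realType) (G : game R) :=
  Topological.copy (mixed2 G) (set_type (simplex R (pure2 G))).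

HB.instance Definition _ (R : realType) (G : game R) :=
  isPointed.Build (mixed2 G)
    (exist (fun p => p \in simplex R (pure2 G)) _
       (vertex_simplex R (enum_val (Ordinal (pure2_gt0 G))))).

Definition borel_mixed2 (R : realType) (G : game R) :=
  g_sigma_algebraType (@open (mixed2 G)).

Section BestResponse.
Context {R : realType} (G : game R).
Implicit Types (s : pure1 G) (sigma : mixed2 G).

Definition eu1 s sigma : R := \sum_t val sigma t * u1 s t.
Definition eu2 s sigma : R := \sum_t val sigma t * u2 s t.

Definition br sigma : {set pure1 G} :=
  [set s | [forall s', eu1 s' sigma <= eu1 s sigma]].

Definition fbr sigma : {set pure1 G} :=
  [set s in br sigma | [forall (s' | s' \in br sigma),
                          eu2 s' sigma <= eu2 s sigma]].

(* The value f(A) of a function f that is constant on the nonempty set A. *)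
Definition value_on (A : {set pure1 G}) (f : pure1 G -> R) : R :=
  if [pick s in A] is Some s then f s else 0.

Definition eu1_br sigma : R := value_on (br sigma) (eu1^~ sigma).
Definition eu2_fbr sigma : R := value_on (fbr sigma) (eu2^~ sigma).

Lemma exists_fbr sigma : exists s, s \in fbr sigma.
Proof.
pose s0 := enum_val (Ordinal (pure1_gt0 G)).
have [s _ smax] := arg_maxP (P := xpredT) (eu1^~ sigma) (isT : xpredT s0).
have sbr : s \in br sigma by rewrite inE; apply/forallP => s'; exact: smax.
have [t tbr tmax] := arg_maxP (P := mem (br sigma)) (eu2^~ sigma) sbr.
exists t; rewrite inE; apply/andP; split; first exact: tbr.
by apply/forallP => s'; apply/implyP; exact: tmax.
Qed.

Lemma eu1_brE sigma s : s \in br sigma -> eu1_br sigma = eu1 s sigma.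
Proof.
move=> sbr; rewrite /eu1_br /value_on; case: pickP => [t|/(_ s)]; last by rewrite sbr.
move: sbr; rewrite !inE => /forallP smax /forallP tmax.
by apply/le_anti; rewrite smax tmax.
Qed.

Lemma eu2_fbrE sigma s : s \in fbr sigma -> eu2_fbr sigma = eu2 s sigma.
Proof.
move=> sbr; rewrite /eu2_fbr /value_on; case: pickP => [t|/(_ s)]; last by rewrite sbr.
move: sbr; rewrite inE => /andP[s1 /forallP smax].
rewrite inE => /andP[t1 /forallP tmax].
by apply/le_anti; rewrite (implyP (smax t) t1) (implyP (tmax s) s1).
Qed.

End BestResponse.

Section MSim.
Context {R : realType} (G : game R).

(* The constructor None of msim_pure1 is the strategy m-sim. *)
Definition msim_pure1 : finType := option (pure1 G).

Definition msim_u1 (c : R) (a : msim_pure1) (sigma : mixed2 G) : R :=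
  if a is Some s then eu1 s sigma else eu1_br sigma - c.

Definition msim_u2 (a : msim_pure1) (sigma : mixed2 G) : R :=
  if a is Some s then eu2 s sigma else eu2_fbr sigma.

Definition msim_mixed1 : Type := simplex R msim_pure1.
Definition msim_mixed2 : Type := probability (borel_mixed2 G) R.
Definition msim_profile : Type := (msim_mixed1 * msim_mixed2)%type.

(* The integrands below are bounded and Borel measurable, so that Rintegral is
   the expectation. *)
Definition msim_payoff1 (c : R) (mu : msim_profile) : R :=
  \int[mu.2]_sigma (\sum_a val mu.1 a * msim_u1 c a sigma).

Definition msim_payoff2 (mu : msim_profile) : R :=
  \int[mu.2]_sigma (\sum_a val mu.1 a * msim_u2 a sigma).

Definition msim_payoff (c : R) (mu : msim_profile) : R * R :=
  (msim_payoff1 c mu, msim_payoff2 mu).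

(* A subgame is given by subsets A1, A2 of pure strategies; its mixed
   strategies are those concentrated on A1, A2. A2 will be finite (hence
   Borel) or the whole space. *)
Definition supp1 (A1 : {set msim_pure1}) (p : msim_mixed1) : Prop :=
  forall a, a \notin A1 -> val p a = 0.

Definition supp2 (A2 : set (mixed2 G)) (mu : msim_mixed2) : Prop :=
  mu A2 = 1%E.

Definition msim_subgame_NE (c : R) (A1 : {set msim_pure1})
    (A2 : set (mixed2 G)) : set msim_profile :=
  [set mu | [/\ supp1 A1 mu.1, supp2 A2 mu.2,
     (forall p, supp1 A1 p ->
        msim_payoff1 c (p, mu.2) <= msim_payoff1 c mu) &
     (forall q, supp2 A2 q ->
        msim_payoff2 (mu.1, q) <= msim_payoff2 mu)]].

Definition msim_NE (c : R) : set msim_profile :=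
  msim_subgame_NE c [set: msim_pure1]%SET [set: mixed2 G].

End MSim.

(* Main.v *)
(** For a pure strategy [s] of player 1, the set of [sigma] to which [s] is a
    best response is a polytope, on which all payoffs are linear in [sigma],
    except that player 2's payoff against m-sim is only bounded below by the
    linear function [eu2 s], with equality where [s] is a favourable best
    response. The subgame keeps all of player 1's strategies and one relative
    interior point of each face of these polytopes (including the vertices).
    Split a belief [q] over player 2's mixed strategies according to the
    favourable best response, and on each piece replace it by a distribution on
    these points with the same barycenter: player 1's payoffs do not change, and
    player 2's do not decrease. Hence a deviation of player 2 can always be moved
    into the subgame, which gives (i), and so can the equilibrium strategy
    itself, which gives (ii). *)
From HB Require Import structures.
Require Import Defs.
From mathcomp Require Import all_boot all_order all_algebra.
From mathcomp Require Import all_classical all_reals all_analysis.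
From mathcomp Require Import measurable_realfun.

Set Implicit Arguments.
Unset Strict Implicit.
Unset Printing Implicit Defensive.

Import Order.TTheory GRing.Theory Num.Theory numFieldNormedType.Exports.

Local Open Scope classical_set_scope.
Local Open Scope ring_scope.

(** * Generators of a pointed polyhedral cone *)

Section Cone.
Context {R : realFieldType} {T I : finType} (a : I -> T -> R).
Implicit Type x : T -> R.

Definition in_cone x := forall i, 0 <= \sum_t x t * a i t.

Definition tight x : {set I} := [set i | \sum_t x t * a i t == 0]%SET.

(* Subtracting from [x] the largest multiple of a point with the same tight
   inequalities that keeps it in the cone makes a further inequality tight. *)
Lemma cone_generated (V : {set I} -> T -> R) :
    (forall x, (forall i, \sum_t x t * a i t = 0) -> forall t, x t = 0) ->
    (forall x, in_cone x -> (exists t, x t != 0) ->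
       in_cone (V (tight x)) /\ tight (V (tight x)) = tight x) ->
  forall x, in_cone x -> exists l : {set I} -> R,
    [/\ forall J, 0 <= l J, forall J, l J != 0 -> in_cone (V J) &
        forall t, x t = \sum_J l J * V J t].
Proof.
(* Induction on the number of inequalities that are slack at [x]. *)
move=> pointed repV x; have [n] := ubnP #|~: tight x|.
elim: n x => // n IHn x; rewrite ltnS => le_n cx.
have [/forallP x0|] := boolP [forall t, x t == 0].
  exists (fun=> 0); split => [//|J|t]; first by rewrite eqxx.
  by rewrite big1 ?(eqP (x0 t)) // => J _; rewrite mul0r.
rewrite negb_forall => /existsP[t0 xt0].
have [cV tV] := repV x cx (ex_intro _ t0 xt0).
set v := V (tight x) in cV tV.
(* The cone is pointed and [x] is nonzero, so the minimum ratio below ranges over a nonempty set. *)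
have [i0 xi0] : exists i, i \notin tight x.
  apply/existsP; rewrite -negb_forall; apply: contra xt0 => /forallP tx.
  apply/eqP/pointed => i; by have := tx i; rewrite inE => /eqP.
have gt0 y i : in_cone y -> i \notin tight y -> 0 < \sum_t y t * a i t.
  by move=> cy; rewrite inE lt_def cy andbT.
have [i iNx imin] := arg_minP (P := fun i => i \notin tight x)
  (fun i => (\sum_t x t * a i t) / (\sum_t v t * a i t)) xi0.
set r := (_ / _) in imin.
have r0 : 0 < r by rewrite divr_gt0 ?gt0 // tV.
pose y t := x t - r * v t.
have yE j : \sum_t y t * a j t = \sum_t x t * a j t - r * \sum_t v t * a j t.
  rewrite mulr_sumr -sumrB; apply: eq_bigr => t _.
  by rewrite mulrBl mulrA.
have cy : in_cone y.
  move=> j; rewrite yE subr_ge0; have [jx|jNx] := boolP (j \in tight x).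
    have := jx; rewrite -tV inE => /eqP ->; rewrite mulr0; exact: cx.
  by rewrite -ler_pdivlMr ?gt0 ?tV // imin.
(* Inequalities tight at [x] are tight at [v], hence at [y]; the minimiser [i] becomes tight as
   well. *)
have ty : (#|~: tight y| < n)%N.
  apply: leq_trans le_n; apply: proper_card; apply/properP; split.
    rewrite finset.setCS; apply/fintype.subsetP => j jx; rewrite inE yE.
    have := jx; rewrite -tV inE => /eqP ->; move: jx; rewrite inE => /eqP ->.
    by rewrite mulr0 subr0.
  exists i; rewrite !inE ?negbK; first by move: iNx; rewrite inE.
  by rewrite yE divfK ?subrr// gt_eqF ?gt0 ?tV.
have [l [l0 lV yl]] := IHn y ty cy.
exists (fun J => l J + r *+ (J == tight x)); split => [J|J|t].
- by rewrite addr_ge0 // mulrn_wge0 // ltW.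
- case: (eqVneq J) => [-> //|_]; rewrite addr0; exact: lV.
- under eq_bigr do rewrite mulrDl.
  rewrite big_split -yl /= (bigD1 (tight x)) //= eqxx mulr1n big1 => [|J /negPf->].
    by rewrite addr0 subrK.
  by rewrite mul0r.
Qed.
End Cone.

(** * Finitely supported probability measures *)

Section DiscreteProbability.
Context d {T : measurableType d} {R : realType} {K : finType}.
Variables (w : K -> {nonneg R}) (v : K -> T).
Hypothesis w1 : \sum_k (w k)%:num = 1.

Let k0 : K.
Proof.
case: (pickP (@predT K)) => [k _|noK]; first exact: k.
by move: w1; rewrite big_pred0 // => /esym/eqP; rewrite oner_eq0.
Qed.

(** [msum] takes a sequence indexed by [nat], so [K] is enumerated; [k0] is only the default of
    [nth]. *)
Let dirac_seq (n : nat) : {measure set T -> \bar R} :=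
  mscale (w (nth k0 (enum K) n)) (dirac (v (nth k0 (enum K) n))).

Definition discrete : set T -> \bar R := msum dirac_seq #|K|.

HB.instance Definition _ := Measure.on discrete.

Let sum_enum (f : K -> \bar R) :
  (\sum_(n < #|K|) f (nth k0 (enum K) n) = \sum_k f k)%E.
Proof. by rewrite -[RHS]big_enum (big_nth k0) -cardE big_mkord. Qed.

Lemma discreteE A : discrete A = (\sum_k (w k)%:num%:E * \d_(v k) A)%E.
Proof. exact: (sum_enum (fun k => (w k)%:num%:E * \d_(v k) A)%E). Qed.

Let discrete_setT : discrete setT = 1%E.
Proof.
rewrite discreteE -w1 -sumEFin; apply: eq_bigr => k _.
by rewrite diracT mule1.
Qed.

HB.instance Definition _ :=
  Measure_isProbability.Build _ _ _ discrete discrete_setT.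

Lemma discrete_supp (A : set T) :
  (forall k, (w k)%:num != 0 -> A (v k)) -> discrete A = 1%E.
Proof.
move=> wA; rewrite discreteE -w1 -sumEFin; apply: eq_bigr => k _.
have [->|/wA/mem_set vA] := eqVneq (w k)%:num 0; first by rewrite mul0e.
by rewrite diracE vA mule1.
Qed.

(** For nonnegative integrands the integral is additive in the measure; the positive and negative
    parts of [f] then have finite integrals, which can be subtracted. *)
Lemma Rintegral_discrete (f : T -> R) : measurable_fun setT f ->
  \int[discrete]_x f x = \sum_k (w k)%:num * f (v k).
Proof.
move=> mf.
have ge0E (g : T -> R) : measurable_fun setT g -> (forall x, 0 <= g x) ->
    (\int[discrete]_x (g x)%:E = (\sum_k (w k)%:num * g (v k))%:E)%E.
  move=> /measurable_EFinP mg g0.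
  rewrite ge0_integral_measure_sum //; last by move=> x _; rewrite lee_fin.
  rewrite -sumEFin -sum_enum; apply: eq_bigr => n _.
  rewrite ge0_integral_mscale //; last by move=> x _; rewrite lee_fin.
  by rewrite integral_dirac // diracT mul1e.
rewrite /Rintegral integralE funerpos funerneg.
rewrite (ge0E (f^\+)%R) ?(ge0E (f^\-)%R) //; last 2 first.
- exact: measurable_funrneg.
- exact: measurable_funrpos.
rewrite -EFinB /= -sumrB; apply: eq_bigr => k _.
by rewrite -mulrBr -[in RHS](funrposBneg f).
Qed.
End DiscreteProbability.

(** * Borel measurability of payoffs and best-response cells *)

Section BoolMeasurability.
Context d {T : measurableType d} {K : finType}.

Lemma measurable_forallb (b : K -> T -> bool) :
  (forall k, measurable_fun setT (b k)) ->
  measurable_fun setT (fun x => [forall k, b k x]).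
Proof.
move=> mb; apply: (measurable_fun_bool true) => //; rewrite setTI.
rewrite (_ : _ @^-1` _ = \bigcap_(k in [set: K]) (b k @^-1` [set true])).
  apply: fin_bigcap_measurable => // k _.
  by rewrite -[X in measurable X]setTI; exact: mb.
by apply/seteqP; split => x /= => [/forallP bx k _|bx];
  [exact: bx|apply/forallP => k; exact: bx].
Qed.

End BoolMeasurability.

Section Borel.
Context {R : realType} {G : game R}.

Lemma measurable_coord t :
  measurable_fun setT (fun sigma : borel_mixed2 G => val (sigma : mixed2 G) t).
Proof.
apply: (measurability _ (RGenOpens.measurableE R)).
move=> _ [_ [a [b ->] <-]]; rewrite setTI.
apply: sub_sigma_algebra => /=.
have cc : continuous (fun sigma : mixed2 G => val sigma t : R).
  move=> s.
  apply: (@continuous_comp _ _ _ (fun sigma : mixed2 G => val sigma)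
           (fun p : {ptws pure2 G -> R} => p t)).
    exact: initial_continuous.
  exact: (@proj_continuous (pure2 G) (fun=> R) t).
by move/continuousP : cc; apply; exact: interval_open.
Qed.

Lemma measurable_linear (b : pure2 G -> R) : measurable_fun setT
  (fun sigma : borel_mixed2 G => \sum_t val (sigma : mixed2 G) t * b t).
Proof.
apply: measurable_sum => t; apply: measurable_funM; last exact: measurable_cst.
exact: measurable_coord.
Qed.

Lemma measurable_br s :
  measurable_fun setT (fun sigma : borel_mixed2 G => s \in br (sigma : mixed2 G)).
Proof.
rewrite (_ : (fun _ => _) = fun sigma : borel_mixed2 G =>
  [forall s', eu1 s' (sigma : mixed2 G) <= eu1 s sigma]); last first.
  by apply/funext => sigma; rewrite inE.
by apply: measurable_forallb => s'; apply: measurable_fun_ler;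
  exact: measurable_linear.
Qed.

Lemma measurable_fbr s :
  measurable_fun setT (fun sigma : borel_mixed2 G => s \in fbr (sigma : mixed2 G)).
Proof.
rewrite (_ : (fun _ => _) = fun sigma : borel_mixed2 G =>
  (s \in br (sigma : mixed2 G)) &&
  [forall s', (s' \notin br (sigma : mixed2 G)) || (eu2 s' sigma <= eu2 s sigma)]);
  last first.
  apply/funext => sigma; rewrite inE; congr (_ && _).
  by apply: eq_forallb => s'; rewrite implybE.
apply: measurable_and; first exact: measurable_br.
apply: measurable_forallb => s'; apply: measurable_or.
  by apply: measurable_neg; exact: measurable_br.
by apply: measurable_fun_ler; exact: measurable_linear.
Qed.

(* [enum_rank] breaks ties, so that the cells partition [mixed2 G]. *)
Definition cell s (sigma : mixed2 G) : bool :=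
  (s \in fbr sigma) &&
  [forall s', (s' \notin fbr sigma) || (enum_rank s <= enum_rank s')%N].

Lemma measurable_cell s :
  measurable_fun setT (fun sigma : borel_mixed2 G => cell s (sigma : mixed2 G)).
Proof.
apply: measurable_and; first exact: measurable_fbr.
apply: measurable_forallb => s'; apply: measurable_or; last exact: measurable_cst.
by apply: measurable_neg; exact: measurable_fbr.
Qed.

(** Only the cell of the favourable best response of least rank contains [sigma], so a single term
    survives. *)
Lemma sum_cell (sigma : mixed2 G) (F : pure1 G -> R) :
  exists2 s, s \in fbr sigma & \sum_s' (cell s' sigma)%:R * F s' = F s.
Proof.
have [s0 s0f] := exists_fbr sigma.
have [s sf smin] := arg_minnP (P := mem (fbr sigma))
  (fun s => nat_of_ord (enum_rank s)) s0f.
exists s; first exact: sf.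
have cs : cell s sigma.
  rewrite /cell; apply/andP; split; first exact: sf.
  apply/forallP => s'; rewrite -implybE; apply/implyP; exact: smin.
rewrite (bigD1 s) //= cs mul1r big1 ?addr0 // => s' s's.
case: (boolP (cell s' sigma)) => [|_]; last by rewrite mul0r.
move=> /andP[s'f /forallP/(_ s)]; rewrite -implybE => /implyP/(_ sf) le1.
have le2 := smin _ s'f; case/eqP: s's; apply: enum_rank_inj; apply: val_inj.
by apply/eqP; rewrite /= eqn_leq le1 le2.
Qed.

End Borel.

Lemma Rintegral_lincomb d (T : measurableType d) (R : realType)
    (mu : {measure set T -> \bar R}) (K : finType) (h : K -> T -> R) (r : K -> R) :
    (forall k, mu.-integrable setT (EFin \o h k)) ->
  \int[mu]_x (\sum_k h k x * r k) = \sum_k (\int[mu]_x h k x) * r k.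
Proof.
move=> ih; rewrite /Rintegral.
have ihr k : mu.-integrable setT (fun x => (h k x * r k)%:E).
  by under eq_fun do rewrite EFinM; apply: integrableZr => //; exact: ih.
under eq_integral do rewrite -sumEFin.
rewrite integral_sum // -sum_fine => [|k _]; last exact: integrable_fin_num.
apply: eq_bigr => k _; exact: RintegralZr.
Qed.

(** * Best-response polytopes and their faces *)

Section Faces.
Context {R : realType} {G : game R}.
Implicit Types (s : pure1 G) (sigma : mixed2 G).

Lemma mixed2_ge0 sigma t : 0 <= val sigma t.
Proof. by have /set_mem[+ _] := valP sigma; exact. Qed.

Lemma mixed2_sum1 sigma : \sum_t val sigma t = 1.
Proof. by have /set_mem[] := valP sigma. Qed.

(** Homogeneous inequalities: they cut out the cone over the polytope of all [sigma] with
    [s \in br sigma], so that barycenters need not be normalised. *)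
Definition br_constraint s (i : pure2 G + pure1 G) (t : pure2 G) : R :=
  match i with
  | inl t' => (t == t')%:R
  | inr s' => u1 s t - u1 s' t
  end.

Lemma br_constraint_coord s t (x : pure2 G -> R) :
  \sum_t' x t' * br_constraint s (inl t) t' = x t.
Proof.
rewrite (bigD1 t) //= eqxx mulr1 big1 ?addr0 // => t' /negPf ->.
by rewrite mulr0.
Qed.

Lemma br_constraint_dev s s' sigma :
  \sum_t val sigma t * br_constraint s (inr s') t = eu1 s sigma - eu1 s' sigma.
Proof. by rewrite -sumrB; apply: eq_bigr => t _; rewrite mulrBr. Qed.

Lemma in_cone_br s sigma : in_cone (br_constraint s) (val sigma) <-> s \in br sigma.
Proof.
rewrite inE; split=> [cs|/forallP brs [t|s']].
- by apply/forallP => s'; have := cs (inr s'); rewrite br_constraint_dev subr_ge0.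
- by rewrite br_constraint_coord mixed2_ge0.
- by rewrite br_constraint_dev subr_ge0.
Qed.

(* A point in the relative interior of a face of [{sigma | s \in br sigma}],
   given by its tight inequalities; junk if there is no such face. One point per
   face, not necessarily a vertex, suffices for [cone_generated]. *)
Definition face_point s (J : {set pure2 G + pure1 G}) : mixed2 G :=
  xget point [set sigma : mixed2 G | in_cone (br_constraint s) (val sigma) /\
                          tight (br_constraint s) (val sigma) = J].

(** The coordinates are among the constraints, so the cone is pointed; rescaling a nonzero point to
    total mass 1 keeps its tight inequalities, so its face has a [face_point]. *)
Lemma br_cone_generated s (x : pure2 G -> R) : in_cone (br_constraint s) x ->
  exists l : {set pure2 G + pure1 G} -> R,
    [/\ forall J, 0 <= l J, forall J, l J != 0 -> s \in br (face_point s J) &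
        forall t, x t = \sum_J l J * val (face_point s J) t].
Proof.
move=> cx.
have [||l [l0 lc xl]] := cone_generated (V := fun J => val (face_point s J)) _ _ cx.
- by move=> y y0 t; have := y0 (inl t); rewrite br_constraint_coord.
- move=> y cy [t0 yt0].
  have y0 t : 0 <= y t by have := cy (inl t); rewrite br_constraint_coord.
  have S0 : 0 < \sum_t y t.
    rewrite (bigD1 t0) //=; apply: ltr_wpDr; first exact: sumr_ge0.
    by rewrite lt_def yt0 y0.
  have sy : (fun t => y t / \sum_t y t) \in simplex R (pure2 G).
    apply/mem_set; split=> [t|]; first by rewrite divr_ge0 // ltW.
    by rewrite -mulr_suml divff // gt_eqF.
  have ye i : \sum_t (y t / \sum_t y t) * br_constraint s i t =
      (\sum_t y t * br_constraint s i t) / \sum_t y t.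
    by rewrite mulr_suml; apply: eq_bigr => t _; rewrite mulrAC.
  pose sigma : mixed2 G := exist (fun p => p \in simplex R (pure2 G)) _ sy.
  suff h : in_cone (br_constraint s) (val sigma) /\
      tight (br_constraint s) (val sigma) = tight (br_constraint s) y.
    exact: (@xgetPex (mixed2 G) point
      [set sigma : mixed2 G | _ /\ _ = _] (ex_intro _ sigma h)).
  split=> [i|] /=; first by rewrite ye divr_ge0 // ltW.
  apply/setP => i; rewrite !inE ye mulf_eq0 invr_eq0 (gt_eqF S0).
  by rewrite orbF.
exists l; split => // J /lc; exact: (in_cone_br s _).1.
Qed.
End Faces.

(** * Moving a belief onto finitely many points *)

Section Discretize.
Context {R : realType} {G : game R} (q : msim_mixed2 G).

(** The barycenter of [q] restricted to the cell of [s], scaled by the mass of that cell. *)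
Definition cell_moment (s : pure1 G) (t : pure2 G) : R :=
  \int[q]_sigma ((cell s (sigma : mixed2 G))%:R * val (sigma : mixed2 G) t).

Lemma measurable_cell_indic s : measurable_fun setT
  (fun sigma : borel_mixed2 G => (cell s (sigma : mixed2 G))%:R : R).
Proof.
rewrite (_ : (fun _ => _) = fun sigma : borel_mixed2 G =>
  if cell s (sigma : mixed2 G) then 1 else 0 : R).
  exact: measurable_fun_ifT (measurable_cell s) _ _.
by apply/funext => sigma; case: (cell _ _).
Qed.

Lemma integrable_cell_coord s t : q.-integrable setT (EFin \o
  (fun sigma : borel_mixed2 G =>
     (cell s (sigma : mixed2 G))%:R * val (sigma : mixed2 G) t : R)).
Proof.
apply: measurable_bounded_integrable => //.
- by rewrite (le_lt_trans (probability_le1 q _)) ?ltry.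
- apply: measurable_funM; [exact: measurable_cell_indic|exact: measurable_coord].
- exists 1; split => // M M1 sigma _ /=; apply: le_trans (ltW M1).
  rewrite ger0_norm; last by rewrite mulr_ge0 ?ler0n ?mixed2_ge0.
  rewrite -[leRHS]mulr1 ler_pM ?ler0n ?mixed2_ge0 // ?lern1 ?leq_b1 //.
  rewrite -(mixed2_sum1 sigma) (bigD1 t) //= lerDl.
  by apply: sumr_ge0 => t' _; exact: mixed2_ge0.
Qed.

Lemma piecewise_linearE (f : mixed2 G -> R) (g : pure1 G -> pure2 G -> R) :
    (forall s sigma, s \in fbr sigma -> f sigma = \sum_t val sigma t * g s t) ->
  f = fun sigma => \sum_k (cell k.1 sigma)%:R * val sigma k.2 * g k.1 k.2.
Proof.
move=> fg; apply/funext => sigma.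
have [s sf <-] := sum_cell sigma (fun s => f sigma).
rewrite -(pair_bigA _ (fun s t => (cell s sigma)%:R * val sigma t * g s t))/=.
apply: eq_bigr => s' _; under [RHS]eq_bigr do rewrite -mulrA.
rewrite -mulr_sumr; case: (boolP (cell s' sigma)) => [/andP[s'f _]|_].
  by rewrite (fg s').
by rewrite !mul0r.
Qed.

(** On each cell [f] is the linear form with coefficients [g s], so its integral depends on [q] only
    through the cell moments. *)
Lemma Rintegral_piecewise_linear (f : mixed2 G -> R)
    (g : pure1 G -> pure2 G -> R) :
    (forall s sigma, s \in fbr sigma -> f sigma = \sum_t val sigma t * g s t) ->
  \int[q]_sigma f sigma = \sum_s \sum_t cell_moment s t * g s t.
Proof.
move=> /piecewise_linearE ->; rewrite pair_bigA /=.
apply: (@Rintegral_lincomb _ (borel_mixed2 G) R q (pure1 G * pure2 G)%type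
  (fun k sigma => (cell k.1 (sigma : mixed2 G))%:R * val (sigma : mixed2 G) k.2)
  (fun k => g k.1 k.2)) => k.
exact: integrable_cell_coord.
Qed.

Lemma measurable_piecewise_linear (f : mixed2 G -> R)
    (g : pure1 G -> pure2 G -> R) :
    (forall s sigma, s \in fbr sigma -> f sigma = \sum_t val sigma t * g s t) ->
  measurable_fun setT (f : borel_mixed2 G -> R).
Proof.
move=> /piecewise_linearE ->; apply: measurable_sum => k.
apply: measurable_funM; last exact: measurable_cst.
apply: measurable_funM; [exact: measurable_cell_indic|exact: measurable_coord].
Qed.

(** Each constraint is linear and nonnegative throughout the cell, and integration preserves
    this. *)
Lemma cell_moment_in_cone s : in_cone (br_constraint s) (cell_moment s).
Proof.
move=> i; rewrite -(@Rintegral_lincomb _ (borel_mixed2 G) R q (pure2 G)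
  (fun t sigma => (cell s (sigma : mixed2 G))%:R * val (sigma : mixed2 G) t));
  last by move=> t; exact: integrable_cell_coord.
apply: Rintegral_ge0 => sigma _; under eq_bigr do rewrite -mulrA.
rewrite -mulr_sumr; case: (boolP (cell s _)) => [/andP[]|_]; last by rewrite mul0r.
by rewrite finset.inE => /andP[/in_cone_br cs _] _; rewrite mul1r.
Qed.

(** Sets [J] that come from no face contribute the default [point], an ordinary strategy of player
    2. *)
Definition face_points : set (mixed2 G) :=
  range (fun k : pure1 G * {set pure2 G + pure1 G} => face_point k.1 k.2).

(* On each cell, [q] is moved to [face_points] without changing its barycenter;
   inequality is only lost where [f] jumps up at such a point. *)
Lemma discretize : exists2 q' : msim_mixed2 G, supp2 face_points q' &
  forall (f : mixed2 G -> R) (g : pure1 G -> pure2 G -> R),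
    (forall s sigma, s \in fbr sigma -> f sigma = \sum_t val sigma t * g s t) ->
    (forall s sigma, s \in br sigma -> \sum_t val sigma t * g s t <= f sigma) ->
    \int[q]_sigma f sigma <= \int[q']_sigma f sigma.
Proof.
have /choice[l lP] s := br_cone_generated (cell_moment_in_cone s).
have l0 s J : 0 <= l s J by have [] := lP s.
have momentE s (b : pure2 G -> R) : \sum_t cell_moment s t * b t =
    \sum_J l s J * \sum_t val (face_point s J) t * b t.
  under [RHS]eq_bigr do rewrite mulr_sumr.
  rewrite exchange_big; apply: eq_bigr => t _ /=.
  have [_ _ ->] := lP s; rewrite mulr_suml.
  by apply: eq_bigr => J _; rewrite mulrA.
pose w (k : pure1 G * {set pure2 G + pure1 G}) := NngNum (l0 k.1 k.2).
(* The constant function 1 is linear on the simplex with all coefficients 1; its integral under [q]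
   gives the total weight. *)
have w1 : \sum_k (w k)%:num = 1.
  transitivity (\int[q]_sigma (fun=> 1 : R) (sigma : mixed2 G)); last first.
    rewrite Rintegral_cst // mul1r; exact: (congr1 fine (probability_setT q)).
  rewrite (Rintegral_piecewise_linear (f := fun=> 1) (g := fun _ _ => 1)); last first.
    by move=> s sigma _; under eq_bigr do rewrite mulr1; rewrite mixed2_sum1.
  rewrite -(pair_bigA _ (fun s J => l s J)) /=; apply: eq_bigr => s _.
  rewrite momentE; apply: eq_bigr => J _.
  by under eq_bigr do rewrite mulr1; rewrite mixed2_sum1 mulr1.
pose v k : borel_mixed2 G := face_point k.1 k.2.
exists (discrete v w1 : probability (borel_mixed2 G) R).
  by apply: discrete_supp => k _; exists k.
move=> f g fg gf; rewrite (Rintegral_piecewise_linear fg).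
rewrite Rintegral_discrete; last exact: measurable_piecewise_linear fg.
rewrite -(pair_bigA _ (fun s J => l s J * f (face_point s J))) /=.
apply: ler_sum => s _; rewrite momentE; apply: ler_sum => J _.
(* A face point may be junk when its weight is zero; otherwise [s] is a best response to it and [gf]
   applies. *)
have [->|lJ] := eqVneq (l s J) 0; first by rewrite !mul0r.
by rewrite ler_wpM2l //; apply: gf; have [_ + _] := lP s; exact.
Qed.
End Discretize.

(** * Payoffs under discretization, and the equilibria *)

Section Payoffs.
Context {R : realType} {G : game R}.
Implicit Types (s : pure1 G) (sigma : mixed2 G).

(** Lets [discretize] be applied to [- f] too; both sides are linear in [g] for fixed cell
    moments. *)
Lemma RintegralN_piecewise_linear (q : msim_mixed2 G) (f : mixed2 G -> R)
    (g : pure1 G -> pure2 G -> R) :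
    (forall s sigma, s \in fbr sigma -> f sigma = \sum_t val sigma t * g s t) ->
  \int[q]_sigma (- f sigma) = - \int[q]_sigma f sigma.
Proof.
move=> fg; rewrite (Rintegral_piecewise_linear q fg).
rewrite (Rintegral_piecewise_linear q (f := fun sigma => - f sigma)
  (g := fun s t => - g s t)) => [|s sigma /fg ->].
  by rewrite -sumrN; apply: eq_bigr => s _; rewrite -sumrN; under eq_bigr do rewrite mulrN.
by rewrite -sumrN; apply: eq_bigr => t _; rewrite mulrN.
Qed.

Lemma linear_mix (K : finType) (r : K -> R) (b : K -> pure2 G -> R) sigma :
  \sum_t val sigma t * (\sum_a r a * b a t) =
  \sum_a r a * \sum_t val sigma t * b a t.
Proof.
under eq_bigr do rewrite mulr_sumr; rewrite exchange_big.
by apply: eq_bigr => a _; rewrite mulr_sumr; apply: eq_bigr => t _; rewrite mulrCA.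
Qed.

Lemma fbr_br s sigma : s \in fbr sigma -> s \in br sigma.
Proof. by rewrite finset.inE => /andP[]. Qed.

Lemma eu2_le_fbr s sigma : s \in br sigma -> eu2 s sigma <= eu2_fbr sigma.
Proof.
move=> sb; have [s' s'f] := exists_fbr sigma; rewrite (eu2_fbrE s'f).
by move: s'f; rewrite finset.inE => /andP[_ /forallP/(_ s)/implyP]; exact.
Qed.

Lemma msim_payoff_discretize (q : msim_mixed2 G) :
  exists q' : msim_mixed2 G, [/\ supp2 face_points q',
    forall c p, msim_payoff1 c (p, q') = msim_payoff1 c (p, q) &
    forall p, msim_payoff2 (p, q) <= msim_payoff2 (p, q')].
Proof.
have [q' sq' leq'] := discretize q; exists q'; split => // [c p|p].
- pose f sigma := \sum_a val p a * msim_u1 c a sigma.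
  pose g s t := \sum_a val p a * (if a is Some s' then u1 s' t else u1 s t - c).
  have fg s sigma : s \in br sigma -> f sigma = \sum_t val sigma t * g s t.
    move=> sb; rewrite linear_mix; apply: eq_bigr => -[s'|] _ //; congr (_ * _).
    rewrite /= (eu1_brE sb) /eu1; under [RHS]eq_bigr do rewrite mulrBr.
    by rewrite sumrB -mulr_suml mixed2_sum1 mul1r.
  have fgf s sigma sf := fg s sigma (fbr_br sf).
  (* By [fg] player 1's payoff is linear on the whole polytope of [s], so [discretize] applies to
     both [f] and [- f]. *)
  rewrite /msim_payoff1 /=; apply/le_anti/andP; split.
  + rewrite -lerN2 -!(RintegralN_piecewise_linear _ fgf).
    apply: (leq' _ (fun s t => - g s t)) => s sigma => [/fbr_br|] /fg ->.
      by rewrite -sumrN; apply: eq_bigr => t _; rewrite mulrN.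
    by rewrite -sumrN; apply: ler_sum => t _; rewrite mulrN.
  + by apply: (leq' f g fgf) => s sigma /fg ->.
- apply: (leq' _ (fun s t => \sum_a val p a * u2 (if a is Some s' then s' else s) t)).
    move=> s sigma sf; rewrite linear_mix.
    by apply: eq_bigr => -[s'|] _ //=; rewrite (eu2_fbrE sf).
  move=> s sigma sb; rewrite linear_mix; apply: ler_sum => a _.
  apply: ler_wpM2l; first by have /set_mem[+ _] := valP p; exact.
  by case: a => [s'|] //=; exact: eu2_le_fbr.
Qed.
End Payoffs.

Theorem proposition3p1 (R : realType) (G : game R) (c : R) (hc : 0 < c) :
  exists (A1 : {set msim_pure1 G}) (A2 : set (mixed2 G)),
    [/\ A1 != finset.set0, A2 !=set0, finite_set A2,
        msim_subgame_NE c A1 A2 `<=` msim_NE c &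
        forall mu : msim_profile G, msim_NE c mu ->
          exists2 mu' : msim_profile G,
            msim_subgame_NE c A1 A2 mu' & msim_payoff c mu' = msim_payoff c mu].
Proof.
exists [set: msim_pure1 G]%SET, face_points; split.
- by apply/finset.set0Pn; exists None; rewrite finset.inE.
- have s := enum_val (Ordinal (pure1_gt0 G)).
  by exists (face_point s finset.set0); exists (s, finset.set0).
- exact/finite_image/finite_finset.
- move=> [p q] [sp sq NE1 NE2]; split => // [|q' _].
    exact: probability_setT.
  have [q'' [sq'' _ le'']] := msim_payoff_discretize q'.
  exact: le_trans (le'' p) (NE2 q'' sq'').
- move=> [p q] [/= sp sq NE1 NE2].
  have [q' [sq' eq1 le2]] := msim_payoff_discretize q.
  (* [q'] is itself a deviation from [q] in the full game, so player 2 cannot gain strictly. *)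
  have eq2 : msim_payoff2 (p, q') = msim_payoff2 (p, q).
    apply/le_anti; rewrite le2 NE2 //.
    exact: probability_setT.
  exists (p, q'); last by rewrite /msim_payoff eq1 eq2.
  split => // [p' sp'|q'' _] /=; first by rewrite !eq1; exact: NE1.
  by rewrite eq2; apply: NE2; exact: probability_setT.
Qed.
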